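(* Let $f$ be a finitary Boolean function. Then $\delta_{B_mf}\to\delta_f$ as $m\to\infty$.
   Context: Let $\Omega=\{-1,1\}$ and $\Omega^\infty=\{-1,1\}^{\mathbb N}$ with the uniform product probability measure; $\omega$ denotes a uniformly random element. A Boolean function is a measurable map $f:\Omega^\infty\to\Omega$. A set $W\subseteq\mathbb N$ is a witness set for $f$ at $\omega$ if there is an event $A$ with $\mathbb P(A)=1$ such that for all $\tilde\omega\in A$: if $\tilde\omega_i=\omega_i$ for all $i\in W$ then $f(\tilde\omega)=f(\omega)$. $f$ is finitary if almost surely a finite witness set exists; then $W(f)(\omega)$ denotes the least finite witness set in the order: smaller maximum first, then smaller cardinality, then lexicographic. $B_mf=\mathbf 1_{\{W(f)\subseteq[m]\}}f-\mathbf 1_{\{W(f)\not\subseteq[m]\}}$. A (randomised) algorithm $A$ for a finitary $g$ queries bits of $\omega$ one at a time, each next index chosen as a function of the bits queried so far and independent auxiliary randomness, and stops once the set of queried bits is a witness set for $g$ at $\omega$; it is required to query almost surely only finitely many bits. $W(A)$ is the (random) set of queried bits. The revealment of $g$ is $\delta_g=\inf_A\sup_i\mathbb P(i\in W(A))$, the infimum over all such algorithms for $g$. *)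

(* Defs.v *)
From HB Require Import structures.
From mathcomp Require Import all_boot all_order all_algebra.
From mathcomp Require Import all_classical all_reals all_analysis.
Set Implicit Arguments. Unset Strict Implicit. Unset Printing Implicit Defensive.
Import Order.TTheory GRing.Theory Num.Theory.
Local Open Scope classical_set_scope.
Local Open Scope ring_scope.

(** The cube Omega^infty = {-1,1}^N, encoded as nat -> bool
    (true <-> +1, false <-> -1), with the product sigma-algebra, i.e. the
    sigma-algebra generated by the coordinate events [w i = b]. *)
Definition coord_events : set (set (nat -> bool)) :=
  [set A | exists (i : nat) (b : bool), A = [set w | w i = b]].

Definition Omega := g_sigma_algebraType coord_events.

(** [P] is the uniform product measure: every finite cylinder fixing
    [size s] distinct coordinates has probability 2^-(size s).
    (This determines P uniquely on the product sigma-algebra.) *)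
Definition uniform_product (R : realType) (P : probability Omega R) : Prop :=
  forall (s : seq nat) (b : nat -> bool), uniq s ->
    P [set w : Omega | forall i, i \in s -> w i = b i] = ((2%:R : R) ^- size s)%:E.

Section Defs.
Variables (R : realType) (P : probability Omega R).

Definition witness (f : Omega -> bool) (W : set nat) (w : Omega) : Prop :=
  exists A : set Omega, measurable A /\ P A = 1%E /\
    forall w' : Omega, A w' -> (forall i, W i -> w' i = w i) -> f w' = f w.

Definition finitary (f : Omega -> bool) : Prop :=
  {ae P, forall w : Omega, exists W : set nat, finite_set W /\ witness f W w}.

(** Finite subsets of nat are represented by strictly increasing sequences. *)
Definition setof (s : seq nat) : set nat := [set i | i \in s].

(** (maximum + 1), with 0 for the empty set (which is below everything). *)
Definition maxkey (s : seq nat) : nat := if s is [::] then 0%N else (last 0%N s).+1.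

Fixpoint lexlt (s t : seq nat) : bool :=
  match s, t with
  | [::], [::] => false
  | [::], _ :: _ => true
  | _ :: _, [::] => false
  | x :: s', y :: t' => (x < y)%N || ((x == y) && lexlt s' t')
  end.

Definition wlt (s t : seq nat) : bool :=
  (maxkey s < maxkey t)%N ||
  ((maxkey s == maxkey t) &&
   ((size s < size t)%N || ((size s == size t) && lexlt s t))).

Definition least_witness (f : Omega -> bool) (w : Omega) (s : seq nat) : Prop :=
  sorted ltn s /\ witness f (setof s) w /\
  forall t, sorted ltn t -> witness f (setof t) w -> t <> s -> wlt s t.

(** B_m f = 1_{W(f) ⊆ [m]} f - 1_{W(f) ⊄ [m]}, with [m] = {0,...,m-1}. *)
Definition Bm (m : nat) (f : Omega -> bool) : Omega -> bool :=
  fun w => if `[< exists s, least_witness f w s /\ all (fun i => (i < m)%N) s >]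
           then f w else false.

(** Randomised algorithms. The auxiliary randomness is a uniform element
    [t] of a second independent copy of Omega^infty; the next queried index
    is [sel h t], where [h] is the history (queried indices with the values
    seen so far). *)
Definition strategy := seq (nat * bool) -> Omega -> nat.

Fixpoint history (sel : strategy) (w t : Omega) (k : nat) : seq (nat * bool) :=
  match k with
  | 0 => [::]
  | k'.+1 => let h := history sel w t k' in
             let i := sel h t in rcons h (i, w i)
  end.

Definition queried (sel : strategy) (w t : Omega) (k : nat) : set nat :=
  setof (map fst (history sel w t k)).

Definition stopped (g : Omega -> bool) (sel : strategy) (w t : Omega) (k : nat)
  : Prop := witness g (queried sel w t k) w.

Definition inW (g : Omega -> bool) (sel : strategy) (x : Omega * Omega) (i : nat)
  : Prop :=
  exists k, stopped g sel x.1 x.2 k /\ (forall j, (j < k)%N -> ~ stopped g sel x.1 x.2 j)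
            /\ queried sel x.1 x.2 k i.

Definition PP := (P \x P)%E.

Definition algorithm_for (g : Omega -> bool) (sel : strategy) : Prop :=
  (forall h n, measurable [set t : Omega | sel h t = n]) /\
  {ae PP, forall x : Omega * Omega, exists k, stopped g sel x.1 x.2 k}.

Definition revealment (g : Omega -> bool) : \bar R :=
  ereal_inf [set ereal_sup (range (fun i => PP [set x | inW g sel x i]))
            | sel in [set sel | algorithm_for g sel]].

End Defs.

(* Main.v *)
Require Import Defs.
From HB Require Import structures.
From mathcomp Require Import all_boot all_order all_algebra.
From mathcomp Require Import all_classical all_reals all_analysis.
Import Order.TTheory GRing.Theory Num.Theory.
Local Open Scope classical_set_scope.
Local Open Scope ring_scope.

Set Implicit Arguments. Unset Strict Implicit. Unset Printing Implicit Defensive.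

(** Say that an algorithm "settles" g when the queried bits force g almost
    everywhere on the corresponding cylinder.

    Upper bound.  Run an algorithm for f; if all the bits it queried lie in [m],
    they also settle B_m f.  Otherwise, an event of vanishing probability, query
    everything.

    Lower bound.  Let U_n be the event that [n] does not settle f; it decreases
    to a null event, and B_m f = f a.s. off U_m.  Given N, choose n so large that
    P(U_n) is tiny compared with 2^-N: then with high probability no change of
    the bits in [N] can lead into U_n, so that seeing the bits of [N, n) is enough
    to know that f = B_m f for every m >= n.  Reveal one of 2^p disjoint such
    blocks, drawn at random (each bit is then revealed with probability at most
    2^-p), and run an algorithm for B_m f: unless the block is bad, its answer
    settles f.  The choice of the blocks does not depend on m.  Only union bounds
    are used, so the draw and the algorithm may share their random bits. *)

(** * Null sets, cylinders and query histories *)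

Lemma negligible_bigcup_countType d (T : sigmaRingType d) (R : realFieldType)
    (mu : {measure set T -> \bar R}) (U : countType) (A : U -> set T) :
  (forall u, mu.-negligible (A u)) -> mu.-negligible (\bigcup_u A u).
Proof.
move=> nA; pose B n := if unpickle n is Some u then A u else set0.
have nB : mu.-negligible (\bigcup_n B n).
  apply: negligible_bigcup => n; rewrite /B.
  by case: unpickle => [u|]; [exact: nA|exact: negligible_set0].
apply: negligibleS nB => x [u _ Aux]; exists (pickle u) => //.
by rewrite /B pickleK.
Qed.

Definition cyl (h : seq (nat * bool)) : set Omega :=
  [set w | all (fun p => w p.1 == p.2) h].

Definition seen (w : Omega) (s : seq nat) : seq (nat * bool) :=
  [seq (i, w i) | i <- s].

Lemma map_fst_seen w s : map fst (seen w s) = s.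
Proof. by rewrite /seen -map_comp map_id_in. Qed.

Lemma seen_cat w s1 s2 : seen w (s1 ++ s2) = seen w s1 ++ seen w s2.
Proof. exact: map_cat. Qed.

Lemma cylP h w : cyl h w -> h = seen w (map fst h).
Proof.
rewrite /cyl /=; elim: h => [//|[i b] h IH] /= /andP[/eqP e /IH {1}->].
by rewrite e.
Qed.

Lemma cyl_seenP w s w' : cyl (seen w s) w' <-> {in s, w' =1 w}.
Proof.
rewrite /cyl /= all_map; split => [/allP h i /h /eqP//|h].
by apply/allP => i /h /= ->.
Qed.

Lemma cyl_seen w s : cyl (seen w s) w.
Proof. by apply/cyl_seenP. Qed.

Lemma cyl_cat h1 h2 : cyl (h1 ++ h2) = cyl h1 `&` cyl h2.
Proof.
apply/seteqP; split=> w; rewrite /cyl /= all_cat; first by move/andP.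
by case=> -> ->.
Qed.

Lemma measurable_coord i b : measurable [set w : Omega | w i = b].
Proof. by apply: sub_sigma_algebra; exists i, b. Qed.

Lemma measurable_cyl h : measurable (cyl h).
Proof.
elim: h => [|[i b] h IH]; first by rewrite (_ : cyl _ = setT) //; apply/seteqP.
rewrite (_ : cyl _ = [set w | w i = b] `&` cyl h).
  by apply: measurableI => //; exact: measurable_coord.
apply/seteqP; split=> w; rewrite /cyl /=; first by case/andP=> /eqP.
by case=> -> ->; rewrite eqxx.
Qed.

Lemma measurable_value (g : Omega -> bool) b :
  measurable_fun setT g -> measurable [set w | g w = b].
Proof. by move=> mg; rewrite -[X in measurable X]setTI; exact: (mg measurableT [set b]). Qed.

Lemma history_seen sel w t k :
  history sel w t k = seen w (map fst (history sel w t k)).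
Proof. by elim: k => [//|k IH] /=; rewrite map_rcons /seen map_rcons -/(seen _ _) -IH. Qed.

Lemma history_sub sel w t k l : (k <= l)%N -> exists h,
  history sel w t l = history sel w t k ++ h.
Proof.
move=> /subnKC <-; elim: (l - k)%N => [|n [h IH]]; first by exists [::]; rewrite addn0 cats0.
rewrite addnS /= IH; eexists; exact: rcons_cat.
Qed.

Lemma queried_le sel w t k l : (k <= l)%N -> queried sel w t k `<=` queried sel w t l.
Proof.
by move=> /(history_sub sel w t)[h e] i; rewrite /queried /setof e /= map_cat mem_cat => ->.
Qed.

(** * Witness sets as values forced on cylinders *)

Section Forcing.
Context (R : realType) (P : probability Omega R).

Definition forces (g : Omega -> bool) h (b : bool) : Prop :=
  P (cyl h `&` [set w | g w <> b]) = 0%E.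

Definition determines (g : Omega -> bool) h : Prop := exists b, forces g h b.

Lemma measurable_disagree (g : Omega -> bool) h b : measurable_fun setT g ->
  measurable (cyl h `&` [set w | g w <> b]).
Proof.
move=> mg; apply: measurableI; first exact: measurable_cyl.
by apply: measurableC; exact: measurable_value.
Qed.

Lemma forces_sub (g : Omega -> bool) h h' b : measurable_fun setT g ->
  cyl h' `<=` cyl h -> forces g h b -> forces g h' b.
Proof.
move=> mg hh; apply: subset_measure0; try exact: measurable_disagree.
exact: setSI.
Qed.

Lemma witness_subset (g : Omega -> bool) (V W : set nat) w :
  V `<=` W -> witness P g V w -> witness P g W w.
Proof.
move=> VW [A [mA [PA H]]]; exists A; split=> //; split=> // w' Aw' h.
by apply: H => // i /VW; exact: h.
Qed.

(** The points of the cylinder where [g] differs from [g w] lie outside the full-measure event [A];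
    conversely, the complement of this null set serves as [A]. *)
Lemma witness_forces (g : Omega -> bool) s w : measurable_fun setT g ->
  witness P g (setof s) w <-> forces g (seen w s) (g w).
Proof.
move=> mg; split=> [[A [mA [PA H]]]|f0].
  have nA : P (~` A) = 0%E by rewrite probability_setC// PA subee.
  apply: (@subset_measure0 _ _ _ P _ (~` A)).
  - exact: measurable_disagree.
  - exact: measurableC.
  - move=> w' [/cyl_seenP ew' ne] Aw'; apply: ne; apply: H => // i; exact: ew'.
  - exact: nA.
exists (~` (cyl (seen w s) `&` [set w' | g w' <> g w])); split.
  by apply: measurableC; exact: measurable_disagree.
split; first by rewrite probability_setC ?f0 ?sube0//; exact: measurable_disagree.
move=> w' nw' e; apply: contra_notP nw' => ne; split=> //.
by apply/cyl_seenP => i; exact: e.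
Qed.

Lemma witness_determines (g : Omega -> bool) s w : measurable_fun setT g ->
  witness P g (setof s) w -> determines g (seen w s).
Proof. by move=> mg /(witness_forces _ _ mg); exists (g w). Qed.

(* [witness] refers to the value of [g] at [w] itself, which may be exceptional;
   [determines] only depends on the history. *)
Definition regular_at (g : Omega -> bool) (w : Omega) : Prop :=
  forall s, determines g (seen w s) -> witness P g (setof s) w.

(** There are countably many pairs of a history and a value forced by it, and the points disobeying
    one such pair form a null set. *)
Lemma ae_regular (g : Omega -> bool) : measurable_fun setT g ->
  {ae P, forall w, regular_at g w}.
Proof.
move=> mg; pose A (u : seq (nat * bool) * bool) :=
  if `[< forces g u.1 u.2 >] then cyl u.1 `&` [set w | g w <> u.2] else set0.
have nA : P.-negligible (\bigcup_u A u).
  apply: negligible_bigcup_countType => u; rewrite /A; case: asboolP => [fu|_].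
    by exists (cyl u.1 `&` [set w | g w <> u.2]); split=> //; exact: measurable_disagree.
  exact: negligible_set0.
apply: negligibleS nA => w /= /existsNP[s /not_implyP[[b fb] nw]].
exists (seen w s, b) => //; rewrite /A /= asboolT//; split; first exact: cyl_seen.
by move=> e; apply: nw; apply/witness_forces => //; rewrite e.
Qed.

Lemma measurable_witness (g : Omega -> bool) s : measurable_fun setT g ->
  measurable [set w | witness P g (setof s) w].
Proof.
move=> mg; pose A (u : seq (nat * bool) * bool) :=
  if `[< forces g u.1 u.2 /\ map fst u.1 = s >] then cyl u.1 `&` [set w | g w = u.2] else set0.
rewrite (_ : [set w | _] = \bigcup_u A u).
  apply: countable_bigcupT_measurable => // u; rewrite /A; case: ifP => // _.
  by apply: measurableI; [exact: measurable_cyl|exact: measurable_value].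
apply/seteqP; split => w /= => [wit|[[h b] _]].
  exists (seen w s, g w) => //; rewrite /A /= asboolT.
    by split=> //; exact: cyl_seen.
  split; first exact/witness_forces.
  exact: map_fst_seen.
rewrite /A /=; case: asboolP => // -[fb es] [/cylP eh /= eb].
by apply/witness_forces => //; rewrite -es -eh eb.
Qed.

End Forcing.

(** * Exhaustive querying in increasing order *)

Lemma exists_notin (s : seq nat) : exists n, n \notin s.
Proof.
exists (\max_(i <- s) i).+1; apply/negP => h.
by have := @leq_bigmax_seq _ s xpredT id _ h isT; rewrite ltnn.
Qed.

Definition fresh (s : seq nat) : nat := ex_minn (exists_notin s).

(** The induction step of the exhaustive phase: an index of [0, n] missing from [s] can only be [n],
    and then [fresh s] is [n]. *)
Lemma iota_fresh n s : {subset iota 0 n <= s} ->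
  {subset iota 0 n.+1 <= rcons s (fresh s)}.
Proof.
rewrite /fresh; case: ex_minnP => m ms minm ns i.
rewrite mem_iota add0n ltnS /= => lin; rewrite mem_rcons inE.
have [//|nis] := boolP (i \in s); first by rewrite orbT.
rewrite orbF eqn_leq; apply/andP; split; last exact: minm.
rewrite (leq_trans lin)// leqNgt; apply: contra ms => lt.
by apply: ns; rewrite mem_iota.
Qed.

Lemma finite_set_iota (W : set nat) : finite_set W ->
  exists n, W `<=` setof (iota 0 n).
Proof.
move=> /finite_seqP[s ->]; exists (\max_(i <- s) i).+1 => i si.
by rewrite /setof /mkset mem_iota /= add0n ltnS (@leq_bigmax_seq _ s xpredT id).
Qed.

(** * Measurability of the events attached to a strategy *)

Lemma measurable_prop (Q : Prop) : measurable [set t : Omega | Q].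
Proof.
have [q|nq] := pselect Q.
  by have -> : [set t : Omega | Q] = setT by apply/seteqP; split.
by have -> : [set t : Omega | Q] = set0 by apply/seteqP; split.
Qed.

Section Measurability.
Context (R : realType) (P : probability Omega R).

Lemma PP_fst A : measurable A -> PP P (A `*` setT) = P A.
Proof. by move=> mA; rewrite /PP product_measure1E//= probability_setT mule1. Qed.

Lemma PP_snd A : measurable A -> PP P (setT `*` A) = P A.
Proof. by move=> mA; rewrite /PP product_measure1E//= probability_setT mul1e. Qed.

Lemma ae_fst (Q : Omega -> Prop) :
  {ae P, forall w, Q w} -> {ae PP P, forall x : Omega * Omega, Q x.1}.
Proof.
move=> [N [mN N0 QN]]; exists (N `*` setT); split.
- exact: measurableX.
- by rewrite PP_fst.
- by move=> x /= nQ; split=> //; exact: QN.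
Qed.

(** The last entry [(i, b)] splits off a condition on [t] (the strategy asks for [i]) and one on [w]
    (that bit is [b]), so by induction the event is a finite intersection of measurable
    rectangles. *)
Lemma measurable_history sel : (forall h n, measurable [set t : Omega | sel h t = n]) ->
  forall k h, measurable [set x : Omega * Omega | history sel x.1 x.2 k = h].
Proof.
move=> msel; elim=> [|k IH] h /=.
  case: h => [|p h]; first by rewrite (_ : [set x | _] = setT)//; exact/seteqP.
  by rewrite (_ : [set x | _] = set0)//; apply/seteqP; split.
case/lastP: h => [|h [i b]].
  rewrite (_ : [set x | _] = set0)//; apply/seteqP; split=> // x /=.
  by move/(congr1 size); rewrite size_rcons.
rewrite (_ : [set x | _] = [set x : Omega * Omega | history sel x.1 x.2 k = h] `&`
   (setT `*` [set t | sel h t = i]) `&` ([set w : Omega | w i = b] `*` setT)).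
  apply: measurableI; first by apply: measurableI => //; exact: measurableX.
  by apply: measurableX => //; exact: measurable_coord.
apply/seteqP; split=> x /=.
  by move=> /rcons_inj[-> <- <-].
by case=> -[-> [_ ->]] [<- _].
Qed.

Lemma measurable_stopped (g : Omega -> bool) sel k : measurable_fun setT g ->
  (forall h n, measurable [set t : Omega | sel h t = n]) ->
  measurable [set x : Omega * Omega | stopped P g sel x.1 x.2 k].
Proof.
move=> mg msel.
rewrite (_ : [set x | _] = \bigcup_(h : seq (nat * bool))
  ([set x : Omega * Omega | history sel x.1 x.2 k = h] `&`
   ([set w | witness P g (setof (map fst h)) w] `*` setT))).
  apply: countable_bigcupT_measurable => // h; apply: measurableI.
    exact: measurable_history.
  by apply: measurableX => //; exact: measurable_witness.
apply/seteqP; split=> x /=; first by exists (history sel x.1 x.2 k).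
by case=> h _ [/= <- [wit _]].
Qed.

Lemma measurable_queried sel k i :
  (forall h n, measurable [set t : Omega | sel h t = n]) ->
  measurable [set x : Omega * Omega | queried sel x.1 x.2 k i].
Proof.
move=> msel.
rewrite (_ : [set x | _] = \bigcup_(h : seq (nat * bool))
  ([set x : Omega * Omega | history sel x.1 x.2 k = h] `&`
   (if i \in map fst h then setT else set0))).
  apply: countable_bigcupT_measurable => // h; apply: measurableI.
    exact: measurable_history.
  by case: ifP.
apply/seteqP; split=> x /=.
  by rewrite /queried /setof /= => q; exists (history sel x.1 x.2 k) => //; rewrite q.
by case=> h _ [/= <-]; rewrite /queried /setof /=; case: ifP.
Qed.

Lemma measurable_inW (g : Omega -> bool) sel i : measurable_fun setT g ->
  (forall h n, measurable [set t : Omega | sel h t = n]) ->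
  measurable [set x : Omega * Omega | inW P g sel x i].
Proof.
move=> mg msel.
rewrite (_ : [set x | _] = \bigcup_k
  ([set x : Omega * Omega | stopped P g sel x.1 x.2 k] `&`
   ~` (\bigcup_(j in [set j | (j < k)%N])
         [set x : Omega * Omega | stopped P g sel x.1 x.2 j]) `&`
   [set x : Omega * Omega | queried sel x.1 x.2 k i])).
  apply: bigcupT_measurable => k; apply: measurableI; last exact: measurable_queried.
  apply: measurableI; first exact: measurable_stopped.
  by apply: measurableC; apply: bigcup_measurable => j _; exact: measurable_stopped.
apply/seteqP; split=> x /=.
  by case=> k [sk [nk qk]]; exists k => //; split=> //; split=> // -[j /= jk]; exact: nk.
case=> k _ [[sk nk] qk]; exists k; split=> //; split=> // j jk sj.
by apply: nk; exists j.
Qed.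

End Measurability.

(** * Turning an algorithm for one function into one for another *)

Section Compose.
Context (R : realType) (P : probability Omega R).
Variables (g g' : Omega -> bool) (pre : Omega -> seq nat) (sel : strategy).
Hypotheses (mg : measurable_fun setT g) (mg' : measurable_fun setT g').

(* The block [pre t] first, then [sel] until the bits seen after the block
   determine [g], then all remaining bits in increasing order. *)
Definition compose : strategy := fun h t =>
  if (size h < size (pre t))%N then nth 0%N (pre t) (size h)
  else if `[< determines P g (drop (size (pre t)) h) >] then fresh (map fst h)
  else sel (drop (size (pre t)) h) t.

Lemma measurable_compose :
  (forall s, measurable [set t : Omega | pre t = s]) ->
  (forall h n, measurable [set t : Omega | sel h t = n]) ->
  forall h n, measurable [set t : Omega | compose h t = n].
Proof.
move=> mpre msel h n.
(* [pre] takes countably many values; once its value is fixed, only the last branch still depends on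
   [t]. *)
rewrite (_ : [set t | _] = \bigcup_(s : seq nat) ([set t : Omega | pre t = s] `&`
  [set t : Omega | (if (size h < size s)%N then nth 0%N s (size h)
     else if `[< determines P g (drop (size s) h) >] then fresh (map fst h)
     else sel (drop (size s) h) t) = n])).
  apply: countable_bigcupT_measurable => // s; apply: measurableI => //.
  case: (size h < size s)%N => /=; first exact: measurable_prop.
  by case: asboolP => _; [exact: measurable_prop|exact: msel].
apply/seteqP; split=> t /=; first by exists (pre t).
by case=> s _ [<-].
Qed.

Lemma history_compose_pre w t k : (k <= size (pre t))%N ->
  history compose w t k = seen w (take k (pre t)).
Proof.
elim: k => [|k IH] lk /=; first by rewrite take0.
rewrite (IH (ltnW lk)).
have -> : compose (seen w (take k (pre t))) t = nth 0%N (pre t) k.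
  by rewrite /compose size_map (size_takel (ltnW lk)) lk.
by rewrite /seen (take_nth 0%N lk) map_rcons.
Qed.

Lemma history_compose_sel w t k :
  (forall j, (j < k)%N -> ~ determines P g (history sel w t j)) ->
  history compose w t (size (pre t) + k) = seen w (pre t) ++ history sel w t k.
Proof.
elim: k => [|k IH] nd; first by rewrite addn0 history_compose_pre// take_size cats0.
rewrite addnS /= IH => [|j jk]; last by apply: nd; exact: leqW.
rewrite -rcons_cat; congr rcons; suff -> : compose (seen w (pre t) ++ history sel w t k) t =
  sel (history sel w t k) t by [].
rewrite /compose size_cat size_map ltnNge leq_addr /= drop_cat size_map ltnn subnn drop0.
by rewrite asboolF//; exact: nd.
Qed.

(** Determination persists as a history grows, so once [sel] has settled [g] every later query is
    fresh, and [n] of them cover [0, n). *)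
Lemma history_compose_fresh w t k n :
  (forall j, (j < k)%N -> ~ determines P g (history sel w t j)) ->
  determines P g (history sel w t k) ->
  {subset iota 0 n <= map fst (history compose w t (size (pre t) + k + n))}.
Proof.
move=> nd [b fb]; elim: n => [//|n IH]; rewrite addnS /= map_rcons /=.
set h := history _ _ _ _ in IH *; suff -> : compose h t = fresh (map fst h) by exact: iota_fresh.
have [h' eh] := history_sub compose w t (leq_addr n (size (pre t) + k)).
rewrite history_compose_sel// -/h -catA in eh.
rewrite /compose eh size_cat size_map ltnNge leq_addr /= drop_cat size_map ltnn subnn drop0.
rewrite asboolT//; exists b; apply: forces_sub fb => //.
by rewrite cyl_cat; exact: subIsetl.
Qed.

Lemma first_stop x : (exists k, stopped P g sel x.1 x.2 k) ->
  exists k, stopped P g sel x.1 x.2 k /\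
    forall j, (j < k)%N -> ~ stopped P g sel x.1 x.2 j.
Proof.
move=> ex; have ex' : exists k, `[< stopped P g sel x.1 x.2 k >].
  by case: ex => k /asboolP; exists k.
case: (ex_minnP ex') => k /asboolP sk mk; exists k; split=> // j jk /asboolP/mk.
by rewrite leqNgt jk.
Qed.

(** [compose] can only test the history, whereas stopping refers to [g w]; at regular points the two
    tests agree. *)
Lemma stopped_determines w t k : regular_at P g w ->
  stopped P g sel w t k <-> determines P g (history sel w t k).
Proof.
move=> rw; split; rewrite /stopped /queried.
  by move/(witness_determines mg); rewrite -history_seen.
by rewrite {1}history_seen; exact: rw.
Qed.

Hypothesis (mpre : forall s, measurable [set t : Omega | pre t = s]).
Hypothesis (fin' : finitary P g').
Hypothesis (alg : algorithm_for P g sel).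

Lemma ae_compose : {ae PP P, forall x : Omega * Omega,
  [/\ regular_at P g x.1, regular_at P g' x.1,
    (exists W, finite_set W /\ witness P g' W x.1) &
    exists k, stopped P g sel x.1 x.2 k]}.
Proof.
have [r r'] := (ae_fst (ae_regular P mg), ae_fst (ae_regular P mg')).
have f' := ae_fst fin'; have [_ s] := alg.
near=> x; split; [near: x; exact: r|near: x; exact: r'|near: x; exact: f'|near: x; exact: s].
Unshelve. all: by end_near. Qed.

(** Once [sel] has stopped, the exhaustive phase eventually covers a finite witness set of [g'],
    which exists almost surely. *)
Lemma compose_algorithm : algorithm_for P g' compose.
Proof.
split; first by apply: measurable_compose => //; exact: alg.1.
apply: filterS ae_compose => x [r r' [W [fW witW]] /first_stop[k [sk nk]]].
have [n Wn] := finite_set_iota fW.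
exists (size (pre x.2) + k + n)%N; apply: witness_subset witW.
apply: (subset_trans Wn) => i; apply: history_compose_fresh.
  by move=> j /nk; apply: contra_not => /stopped_determines; exact.
exact/stopped_determines.
Qed.

(* Off [E], the block and the run of [sel] settle [g'], so nothing else is queried. *)
Lemma inW_compose (E : set (Omega * Omega)) : measurable E ->
  (forall x, ~ E x -> forall k, stopped P g sel x.1 x.2 k ->
    (forall j, (j < k)%N -> ~ stopped P g sel x.1 x.2 j) ->
    determines P g' (seen x.1 (pre x.2) ++ history sel x.1 x.2 k)) ->
  forall i, (PP P [set x | inW P g' compose x i] <=
    PP P [set x | inW P g sel x i] + P [set t | i \in pre t] + PP P E)%E.
Proof.
move=> mE HE i; have [Z [mZ Z0 HZ]] := ae_compose.
have mi : measurable [set t | i \in pre t].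
  rewrite (_ : [set t | _] = \bigcup_(s : seq nat) ([set t : Omega | pre t = s] `&`
    if i \in s then setT else set0)).
    by apply: countable_bigcupT_measurable => // s; apply: measurableI => //; case: ifP.
  apply/seteqP; split=> t /=; first by move=> a; exists (pre t) => //; rewrite a.
  by case=> s _ [<-]; case: ifP.
have mX : measurable ([set x : Omega * Omega | inW P g sel x i] `|`
    (setT `*` [set t | i \in pre t]) `|` E).
  apply: measurableU => //; apply: measurableU; last exact: measurableX.
  by apply: measurable_inW => //; exact: alg.1.
apply: (@le_trans _ _ (PP P ([set x | inW P g sel x i] `|`
    (setT `*` [set t | i \in pre t]) `|` E `|` Z))).
  apply: le_measure; rewrite ?inE.
  - by apply: measurable_inW => //; exact: compose_algorithm.1.
  - exact: measurableU.
  move=> x /= [l [sl [nl ql]]].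
  have [Zx|nZ] := pselect (Z x); first by right.
  have [Ex|nE] := pselect (E x); [by left; right|left; left].
  have [r r' [W [fW witW]] /first_stop[k [sk nk]]] := contra_notP (@HZ x) nZ.
  (* After the block and [k] queries of [sel] the history determines [g'] by [HE], and regularity
     makes it a witness, so the first stop [l] comes no later. *)
  have lk : (l <= size (pre x.2) + k)%N.
    rewrite leqNgt; apply/negP => /nl; apply; rewrite /stopped /queried.
    rewrite history_compose_sel; last first.
      by move=> j /nk; apply: contra_not => /stopped_determines; exact.
    apply: r'; rewrite map_cat map_fst_seen seen_cat -history_seen.
    exact: HE.
  have := queried_le lk ql; rewrite /queried /setof /= history_compose_sel; last first.
    by move=> j /nk; apply: contra_not => /stopped_determines; exact.
  rewrite map_cat mem_cat map_fst_seen => /orP[ip|iq]; first by right.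
  by left; exists k.
rewrite /PP measureU0//.
apply: (le_trans (measureU2 _ _ _)) => //.
  apply: measurableU; last exact: measurableX.
  by apply: measurable_inW => //; exact: alg.1.
apply: leeD => //; apply: (le_trans (measureU2 _ _ _)) => //.
- by apply: measurable_inW => //; exact: alg.1.
- exact: measurableX.
- by apply: leeD => //; rewrite -PP_snd.
Qed.

End Compose.

(** * The order on finite witness sets *)

Lemma lexlt_trans : transitive lexlt.
Proof.
move=> t s u; elim: s t u => [|x s IH] [|y t] [|z u] //=.
case/orP => [xy|/andP[/eqP -> st]] /orP[yz|/andP[/eqP <- tu]].
- by rewrite (ltn_trans xy yz).
- by rewrite xy.
- by rewrite yz.
- by rewrite eqxx (IH _ _ st tu) orbT.
Qed.

Lemma lexlt_total s t : s != t -> lexlt s t || lexlt t s.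
Proof.
elim: s t => [|x s IH] [|y t] //=; rewrite eqseq_cons.
by case: ltngtP => //= _ /IH.
Qed.

Lemma wlt_trans : transitive wlt.
Proof.
move=> t s u; rewrite /wlt.
case/orP => [st|/andP[/eqP -> st]] /orP[tu|/andP[/eqP <- tu]].
- by rewrite (ltn_trans st tu).
- by rewrite st.
- by rewrite tu.
- rewrite eqxx /=; apply/orP; right; move: st tu.
  case/orP => [st|/andP[/eqP -> st]] /orP[tu|/andP[/eqP <- tu]].
  + by rewrite (ltn_trans st tu).
  + by rewrite st.
  + by rewrite tu.
  + by rewrite eqxx (lexlt_trans st tu) orbT.
Qed.

Lemma wlt_total s t : s != t -> wlt s t || wlt t s.
Proof.
move=> /lexlt_total; rewrite /wlt.
by case: (ltngtP (maxkey s)) => //= _; case: (ltngtP (size s)).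
Qed.

Lemma wlt_min (s0 : seq nat) l : exists2 s, s \in s0 :: l &
  forall t, t \in s0 :: l -> t <> s -> wlt s t.
Proof.
elim: l s0 => [|s1 l IH] s0.
  by exists s0; rewrite ?mem_head// => t; rewrite inE => /eqP.
have [s sl smin] := IH s1; have [e|/wlt_total/orP[lt|lt]] := eqVneq s0 s.
- exists s; first by rewrite inE sl orbT.
  by move=> t; rewrite inE e => /orP[/eqP //|]; exact: smin.
- exists s0; rewrite ?mem_head// => t; rewrite inE => /orP[/eqP //|tl _].
  by have [->//|/eqP ts] := eqVneq t s; exact: wlt_trans lt (smin _ tl ts).
- exists s; first by rewrite inE sl orbT.
  by move=> t; rewrite inE => /orP[/eqP -> //|]; exact: smin.
Qed.

Lemma maxkey_leq m s : sorted ltn s -> (maxkey s <= m)%N = all (fun i => (i < m)%N) s.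
Proof.
case/lastP: s => [//|s y] sy.
have -> : maxkey (rcons s y) = y.+1 by case: s {sy} => //= x s; rewrite last_rcons.
rewrite all_rcons; case: ltnP => //= ym; apply/esym/allP => x xs.
apply: ltn_trans ym; move: sy; rewrite (sorted_pairwise ltn_trans) pairwise_rcons.
by case/andP=> /allP/(_ _ xs).
Qed.

(** * The functions [Bm P m f] *)

Section BmTheory.
Context (R : realType) (P : probability Omega R) (f : Omega -> bool).

(** The increasing sequences in [m] are the masks of [iota 0 m], a finite list, so there is a least
    witness among them. A sequence not contained in [m] has a larger [maxkey] and loses at the first
    comparison. *)
Lemma least_witness_iota m w : witness P f (setof (iota 0 m)) w ->
  exists s, least_witness P f w s /\ all (fun i => (i < m)%N) s.
Proof.
move=> wit; pose L := [seq mask (val b) (iota 0 m) | b <- enum {: m.-tuple bool}].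
have LP s : sorted ltn s -> all (fun i => (i < m)%N) s -> s \in L.
  move=> ss sm; apply/mapP.
  have sz : size [seq i \in s | i <- iota 0 m] == m by rewrite size_map size_iota.
  exists (Tuple sz); first by rewrite mem_enum.
  rewrite /= -filter_mask; apply: (irr_sorted_eq ltn_trans ltnn) => //.
    by apply: sorted_filter; [exact: ltn_trans|exact: iota_ltn_sorted].
  move=> i; rewrite mem_filter mem_iota /= add0n.
  by have [/(allP sm) ->|] := boolP (i \in s).
pose L' := [seq s <- L | `[< witness P f (setof s) w >]].
have iL : iota 0 m \in L'.
  rewrite mem_filter; apply/andP; split; first exact/asboolP.
  by apply: LP; [exact: iota_ltn_sorted|apply/allP => i; rewrite mem_iota].
have [s sL smin] := wlt_min (iota 0 m) L'.
have {}sL : s \in L' by move: sL; rewrite inE => /orP[/eqP ->|].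
move: (sL); rewrite mem_filter => /andP[/asboolP ws /mapP[b _ es]].
have ss : sorted ltn s by rewrite es; apply: sorted_mask; [exact: ltn_trans|exact: iota_ltn_sorted].
have sm : all (fun i => (i < m)%N) s.
  by rewrite es; apply/allP => i /mem_mask; rewrite mem_iota.
exists s; split=> //; split=> //; split=> // t st wt ts.
have [tm|tm] := boolP (all (fun i => (i < m)%N) t).
  apply: smin => //; rewrite inE mem_filter LP// andbT; apply/orP; right; exact/asboolP.
rewrite -maxkey_leq// -ltnNge in tm.
by rewrite /wlt (leq_ltn_trans _ tm)// maxkey_leq.
Qed.

(** A witness set stays one when enlarged, so the least one lies in [m] exactly when [m] itself is a
    witness set. This form replaces the order on witnesses from here on. *)
Lemma BmE m w : Bm P m f w = f w && `[< witness P f (setof (iota 0 m)) w >].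
Proof.
rewrite /Bm; case: asboolP => [[s [[ss [ws _]] sm]]|nw].
  rewrite asboolT ?andbT//; apply: witness_subset ws => i /(allP sm) im.
  by rewrite /setof /mkset mem_iota.
by case: asboolP => [/least_witness_iota/nw//|_]; rewrite andbF.
Qed.

Hypothesis (mf : measurable_fun setT f).

Lemma measurable_Bm m : measurable_fun setT (Bm P m f).
Proof.
apply: (@measurable_fun_bool _ _ setT _ true) => //; rewrite setTI.
rewrite (_ : _ @^-1` _ = [set w | f w = true] `&` [set w | witness P f (setof (iota 0 m)) w]).
  by apply: measurableI; [exact: measurable_value|exact: measurable_witness].
apply/seteqP; split=> w /=; rewrite BmE.
  by case/andP => -> /asboolP.
by case=> -> /asboolP ->.
Qed.

(** For the value false it suffices that [Bm] is pointwise below [f]. For the value true, a point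
    obeying [h] has [m] as a witness set, because its cylinder over [m] refines that of [h]. *)
Lemma forces_Bm m h b : all (fun p => (p.1 < m)%N) h ->
  forces P f h b -> forces P (Bm P m f) h b.
Proof.
move=> hm fb; apply: (subset_measure0 _ _ _ fb).
- exact: measurable_disagree (measurable_Bm m).
- exact: measurable_disagree.
move=> w [hw /= ne]; split=> //= fw; apply: ne; 
rewrite BmE fw; case: b fb fw => //= fb fw.
apply/asboolP/witness_forces => //; rewrite fw; apply: forces_sub fb => // w' /cyl_seenP e.
move/cylP: hw => eh; move: hm; rewrite eh; elim: (map fst h) => [//|i s IH] /= /andP[im /IH].
by rewrite /cyl /= => ->; rewrite andbT e ?mem_iota.
Qed.

(** If the first [m] bits do not determine [f], then no point of their cylinder has [m] as a witness
    set, and [Bm] is constantly false there. *)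
Lemma determines_Bm_iota m w : determines P (Bm P m f) (seen w (iota 0 m)).
Proof.
have [[b fb]|nd] := pselect (determines P f (seen w (iota 0 m))).
  exists b; apply: forces_Bm => //.
  by apply/allP => p /mapP[i]; rewrite mem_iota => im ->.
exists false; rewrite /forces (_ : _ `&` _ = set0) ?measure0//.
apply/seteqP; split=> // w' [/cyl_seenP e /=]; rewrite BmE => ne; apply: nd.
have {}ne : witness P f (setof (iota 0 m)) w' by apply: contra_notP ne => nw; rewrite asboolF ?andbF.
have -> : seen w (iota 0 m) = seen w' (iota 0 m).
  by apply/eq_in_map => i /e ->.
exact: witness_determines ne.
Qed.

Lemma finitary_Bm m : finitary P (Bm P m f).
Proof.
apply: filterS (ae_regular P (measurable_Bm m)) => w r.
exists (setof (iota 0 m)); split; first exact: finite_seq.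
by apply: r; exact: determines_Bm_iota.
Qed.

(** The event U_n. Using [determines] rather than [witness] makes it depend exactly on the first [n]
    bits, with no exceptional null set. *)
Definition undecided n (w : Omega) : Prop := ~ determines P f (seen w (iota 0 n)).

Lemma undecided_le n m w : (n <= m)%N -> undecided m w -> undecided n w.
Proof.
move=> nm; apply: contra_not => -[b fb]; exists b; apply: forces_sub fb => // w' /cyl_seenP e.
apply/cyl_seenP => i; rewrite mem_iota => /= im; apply: e; rewrite mem_iota /=.
exact: leq_trans im nm.
Qed.

Lemma ae_Bm_eq m : {ae P, forall w, ~ undecided m w -> Bm P m f w = f w}.
Proof.
apply: filterS (ae_regular P mf) => w r /contrapT/r wit.
by rewrite BmE asboolT// andbT.
Qed.

End BmTheory.

(** * Counting for events that depend on finitely many bits *)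

Lemma ereal_cvg0_near_lt (R : realType) (u : (\bar R)^nat) (c : R) : 0 < c ->
  u n @[n --> \oo] --> 0%E -> \forall n \near \oo, (u n < c%:E)%E.
Proof.
move=> c0 /fine_cvgP[ufin /cvgr_lt/(_ c c0)]; apply: filterS2 ufin => n ufin.
by rewrite /= -lte_fin fineK.
Qed.

Definition depends_on n (A : set Omega) : Prop :=
  forall w w', {in iota 0 n, w' =1 w} -> A w -> A w'.

Lemma nth_tuple_of (w : Omega) n i : (i < n)%N ->
  nth false [tuple w i | i < n] i = w i.
Proof. by move=> lin; exact: (nth_mktuple _ false (Ordinal lin)). Qed.

(** Patterns are padded with [false] beyond [n]; for an event with [depends_on n] the padding does
    not affect membership. *)
Definition patterns n (A : set Omega) : pred (n.-tuple bool) :=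
  fun x => `[< A (nth false x) >].

Section Counting.
Context (R : realType) (P : probability Omega R).

Lemma depends_onE n A : depends_on n A ->
  A = \bigcup_(x in [set` enum (@patterns n A)]) cyl (seen (nth false x) (iota 0 n)).
Proof.
move=> dA; apply/seteqP; split=> w.
  move=> Aw; pose x := [tuple w i | i < n].
  have xE : {in iota 0 n, nth false x =1 w}.
    move=> i; rewrite mem_iota /= => lin.
    exact: nth_tuple_of.
  exists x; last by apply/cyl_seenP => i /xE ->.
  rewrite /= mem_enum; apply/asboolP; exact: dA Aw.
case=> x /=; rewrite mem_enum => /asboolP Ax /cyl_seenP e; exact: dA Ax.
Qed.

Lemma measurable_depends_on n A : depends_on n A -> measurable A.
Proof.
move=> /depends_onE ->; apply: fin_bigcup_measurable; first exact: finite_seq.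
by move=> x _; exact: measurable_cyl.
Qed.

Hypothesis hP : uniform_product P.

Lemma measure_cyl_iota n (b : Omega) : P (cyl (seen b (iota 0 n))) = ((2%:R : R) ^- n)%:E.
Proof.
rewrite (_ : cyl _ = [set w : Omega | forall i, i \in iota 0 n -> w i = b i]).
  by rewrite hP ?iota_uniq// size_iota.
by apply/seteqP; split=> w /cyl_seenP.
Qed.

Lemma measure_depends_on n A : depends_on n A ->
  P A = (#|@patterns n A|%:R * (2%:R : R) ^- n)%:E.
Proof.
move=> dA; rewrite {1}(depends_onE dA) measure_fin_bigcup.
- rewrite -fsbig_seq ?enum_uniq//= (eq_bigr (fun=> ((2%:R : R) ^- n)%:E)).
    by rewrite sumEFin big_const_seq count_predT -cardE iter_addr_0 mulr_natl.
  by move=> x _; exact: measure_cyl_iota.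
- exact: finite_seq.
- apply/trivIsetP => x y _ _ /eqP xy; apply/seteqP; split=> // w [/cyl_seenP ex /cyl_seenP ey].
  apply: xy; apply: eq_from_tnth => i; rewrite !(tnth_nth false).
  by rewrite -ex ?mem_iota//= ey ?mem_iota/=.
- by move=> x _; exact: measurable_cyl.
Qed.

(* The w that can be brought into [A] by changing bits in [0, N) (for [A]
   depending on [0, n) only). *)
Definition forgetful N n (A : set Omega) : set Omega :=
  [set w : Omega | exists w' : Omega, {in iota N (n - N), w' =1 w} /\ A w'].

Lemma depends_on_forgetful N n A : (N <= n)%N -> depends_on n (forgetful N n A).
Proof.
move=> Nn w w' e [v [vw Av]]; exists v; split=> // i iN; rewrite vw// e//.
by move: iN; rewrite !mem_iota subnKC// => /andP[].
Qed.

(** Each pattern on the left is spliced from its own first [N] bits and a pattern of [A], so it lies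
    in the image of a product with 2^N choices for the first factor. *)
Lemma card_patterns_forgetful N n A : (N <= n)%N -> depends_on n A ->
  (#|@patterns n (forgetful N n A)| <= 2 ^ N * #|@patterns n A|)%N.
Proof.
move=> Nn dA.
pose splice (p : N.-tuple bool * n.-tuple bool) : n.-tuple bool :=
  [tuple if (i < N)%N then nth false p.1 i else tnth p.2 i | i < n].
have -> : (2 ^ N = #|{: N.-tuple bool}|)%N by rewrite card_tuple card_bool.
rewrite -cardX; apply: leq_trans (leq_image_card splice _).
apply/subset_leq_card/fintype.subsetP => x /asboolP[w' [e Aw']].
have Bu : @patterns n A [tuple w' i | i < n].
  apply/asboolP; apply: (dA w' _ _ Aw') => i; rewrite mem_iota => /= lin.
  exact: nth_tuple_of.
apply/fintype.imageP; exists ([tuple nth false x i | i < N], [tuple w' i | i < n]); first exact: Bu.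
apply: eq_from_tnth => i; rewrite tnth_mktuple /= (tnth_nth false).
case: ltnP => iN.
  by rewrite (@nth_tuple_of (nth false x)).
by rewrite tnth_mktuple e// mem_iota iN subnKC//=.
Qed.

Lemma measure_forgetful N n A : (N <= n)%N -> depends_on n A ->
  (P (forgetful N n A) <= ((2%:R : R) ^+ N)%:E * P A)%E.
Proof.
move=> Nn dA; rewrite (measure_depends_on dA).
rewrite (measure_depends_on (depends_on_forgetful Nn)) -EFinM lee_fin mulrA.
apply: ler_wpM2r; first by rewrite invr_ge0 exprn_ge0.
by rewrite -natrX -natrM ler_nat card_patterns_forgetful.
Qed.

Variable f : Omega -> bool.
Hypotheses (mf : measurable_fun setT f) (finf : finitary P f).

Lemma depends_on_undecided n : depends_on n (undecided P f n).
Proof.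
move=> w w' e; rewrite /undecided (_ : seen w' _ = seen w (iota 0 n))//.
by apply/eq_in_map => i /e ->.
Qed.

(** A point in every U_n has no finite witness set, so the intersection is null by finitarity;
    continuity from above concludes. *)
Lemma undecided_cvg0 : P (undecided P f n) @[n --> \oo] --> 0%E.
Proof.
have mU n : measurable (undecided P f n) by exact: measurable_depends_on (@depends_on_undecided n).
have mI : measurable (\bigcap_n undecided P f n) by exact: bigcapT_measurable.
have <- : P (\bigcap_n undecided P f n) = 0%E.
  apply/(negligibleP _ mI); apply: negligibleS finf => w nw [W [fW wit]].
  have [n Wn] := finite_set_iota fW; apply: (nw n I).
  exact: witness_determines mf (witness_subset Wn wit).
apply: nonincreasing_cvg_mu => //.
  by rewrite (le_lt_trans (probability_le1 _ _)) ?ltry.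
by move=> n m nm; apply/subsetPset => w; exact: undecided_le.
Qed.

Lemma exists_forgetful_small N (e : R) : 0 < e -> exists n, (N <= n)%N /\
  (P (forgetful N n (undecided P f n)) <= e%:E)%E.
Proof.
(* Dividing by 2^N compensates for the factor lost in [measure_forgetful]. *)
move=> e0; have e0' : 0 < e / 2%:R ^+ N by rewrite divr_gt0// exprn_gt0.
have [n0 _ Hn] : \forall n \near \oo, (P (undecided P f n) < (e / 2%:R ^+ N)%:E)%E.
  exact: ereal_cvg0_near_lt undecided_cvg0.
exists (maxn N n0); split; first exact: leq_maxl.
apply: le_trans (measure_forgetful _ (@depends_on_undecided _)) _; first exact: leq_maxl.
rewrite -(@divfK _ (2%:R ^+ N) _ e) ?expf_neq0// mulrC EFinM; apply: lee_wpmul2l.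
  by rewrite lee_fin exprn_ge0.
by apply/ltW/Hn => /=; exact: leq_maxr.
Qed.

End Counting.

(** * Revealment as an infimum *)

Section Revealment.
Context (R : realType) (P : probability Omega R).

Definition max_reveal (g : Omega -> bool) (sel : strategy) : \bar R :=
  ereal_sup (range (fun i => PP P [set x | inW P g sel x i])).

Lemma revealment_le g sel : algorithm_for P g sel ->
  (revealment P g <= max_reveal g sel)%E.
Proof. by move=> a; apply: ereal_inf_lbound; exists sel. Qed.

Lemma max_reveal_ub g sel i :
  (PP P [set x | inW P g sel x i] <= max_reveal g sel)%E.
Proof. by apply: ereal_sup_ubound; exists i. Qed.

Lemma revealment_ge0 g : (0 <= revealment P g)%E.
Proof.
apply: le_ereal_inf_tmp => _ [sel _ <-].
by apply: le_trans (max_reveal_ub g sel 0%N); rewrite /PP measure_ge0.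
Qed.

Lemma revealment_adherent g (e : R) : 0 < e -> revealment P g \is a fin_num ->
  exists sel, algorithm_for P g sel /\ (max_reveal g sel < revealment P g + e%:E)%E.
Proof.
by move=> e0 /(lb_ereal_inf_adherent e0)[_ [sel alg <-] lt]; exists sel.
Qed.

Variable f : Omega -> bool.
Hypotheses (mf : measurable_fun setT f) (finf : finitary P f).

(** * The upper bound: from [f] to [Bm P m f] *)

Section Upper.
Variable (sel : strategy).
Hypothesis (alg : algorithm_for P f sel).

Definition escapes m : set (Omega * Omega) :=
  \bigcup_(i in [set i | (m <= i)%N]) [set x | inW P f sel x i].

Lemma measurable_escapes m : measurable (escapes m).
Proof. by apply: bigcup_measurable => i _; apply: measurable_inW => //; exact: alg.1. Qed.

(** A run that stops has queried finitely many bits, and [inW] never holds for a run that does not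
    stop, so the events decrease to the empty set. *)
Lemma escapes_cvg0 : PP P (escapes m) @[m --> \oo] --> 0%E.
Proof.
have I0 : \bigcap_m escapes m = set0.
  apply/seteqP; split=> // x /= H; have [i _ [k [sk [nk _]]]] := H 0%N I.
  have [n Hn] : exists n, queried sel x.1 x.2 k `<=` setof (iota 0 n).
    by apply: finite_set_iota; exact: finite_seq.
  have [j /= nj [k' [sk' [nk' /[dup] qj]]]] := H n I.
  have -> : k' = k by case: (ltngtP k' k) => // [/nk|/nk'].
  by move/Hn; rewrite /setof /mkset mem_iota /= add0n ltnNge nj.
have := @nonincreasing_cvg_mu _ _ R (P \x P)%E escapes.
rewrite I0 measure0; apply.
- by rewrite (le_lt_trans (probability_le1 _ _)) ?ltry//; exact: measurable_escapes.
- exact: measurable_escapes.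
- by rewrite -I0; apply: bigcapT_measurable; exact: measurable_escapes.
- by move=> m n mn; apply/subsetPset => x [i /= ni ii]; exists i => //=; exact: leq_trans mn ni.
Qed.

Lemma revealment_Bm_le (e : R) : 0 < e ->
  \forall m \near \oo, (revealment P (Bm P m f) <= max_reveal f sel + e%:E)%E.
Proof.
move=> e0; have := ereal_cvg0_near_lt e0 escapes_cvg0; apply: filterS => m Em.
(* With an empty block, [compose] runs [sel] and then, if necessary, queries everything; [escapes m]
   is the exceptional event. *)
pose pre (t : Omega) : seq nat := [::].
have mpre s : measurable [set t : Omega | pre t = s] by exact: (measurable_prop ([::] = s)).
have mB := measurable_Bm P mf m.
have finB := finitary_Bm P mf m.
apply: le_trans (revealment_le (compose_algorithm mf mB mpre finB alg)) _.
apply: ge_ereal_sup => _ [i _ <-].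
apply: le_trans (inW_compose mf mB mpre finB alg (measurable_escapes m) _ i) _; last first.
  have -> : [set t | i \in pre t] = set0 by apply/seteqP; split.
  by rewrite measure0 adde0; apply: leeD; [exact: max_reveal_ub|exact: ltW].
move=> x nE k sk nk; rewrite cat0s.
have [b fb] : determines P f (history sel x.1 x.2 k).
  by rewrite history_seen; exact: witness_determines sk.
exists b; apply: forces_Bm fb => //; apply/allP => p ph; rewrite ltnNge; apply/negP => mp.
apply: nE; exists p.1 => //; exists k; split=> //; split=> //.
by apply/mapP; exists p.
Qed.

End Upper.

(** * The lower bound: from [Bm P m f] back to [f] *)

Section Lower.
Hypothesis hP : uniform_product P.
Variables (p : nat) (eta : R).
Hypothesis (eta0 : 0 < eta).

(** The blocks are the intervals [[cut j], [cut j.+1]), each chosen long enough for its left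
    endpoint; the construction depends on [f] and [eta] but not on [m]. *)
Definition cut (j : nat) : nat :=
  iter j (fun N => sval (cid (exists_forgetful_small hP mf finf N eta0))) 0%N.

Lemma cutP j : (cut j <= cut j.+1)%N /\
  (P (forgetful (cut j) (cut j.+1) (undecided P f (cut j.+1))) <= eta%:E)%E.
Proof. exact: svalP (cid (exists_forgetful_small hP mf finf (cut j) eta0)). Qed.

Lemma cut_le j k : (j <= k)%N -> (cut j <= cut k)%N.
Proof.
move=> /subnKC <-; elim: (k - j)%N => [|n IH]; first by rewrite addn0.
by rewrite addnS; apply: leq_trans IH (cutP _).1.
Qed.

(** The first [p] auxiliary bits number one of 2^p blocks; the same [t] is later passed to [sel]. *)
Definition draw (t : Omega) : 'I_#|{: p.-tuple bool}| := enum_rank [tuple t l | l < p].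

Definition block (t : Omega) : seq nat := iota (cut (draw t)) (cut (draw t).+1 - cut (draw t)).

Lemma mem_block t i : i \in block t -> (cut (draw t) <= i < cut (draw t).+1)%N.
Proof. by rewrite mem_iota subnKC//; exact: (cutP _).1. Qed.

Lemma draw_eqP t t' : {in iota 0 p, t' =1 t} <-> draw t' = draw t.
Proof.
split=> [e|/enum_rank_inj e i].
  congr enum_rank; apply: eq_from_tnth => l.
  by rewrite !tnth_mktuple e// mem_iota /=.
by rewrite mem_iota => /= lin; rewrite -(nth_tuple_of t' lin) e nth_tuple_of.
Qed.

Lemma measurable_block s : measurable [set t : Omega | block t = s].
Proof.
by apply: (@measurable_depends_on p) => t t' /draw_eqP e; rewrite /= /block e.
Qed.

(** The blocks are disjoint, so [i] lies in at most one of them, and the event is contained in the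
    cylinder of the [p] bits that draw this block. *)
Lemma measure_block i : (P [set t : Omega | i \in block t] <= ((2%:R : R) ^- p)%:E)%E.
Proof.
have dB : depends_on p [set t : Omega | i \in block t].
  by move=> t t' /draw_eqP e; rewrite /= /block e.
have [[t0 it0]|no] := pselect (exists t : Omega, i \in block t); last first.
  rewrite (_ : [set t | _] = set0) ?measure0 ?lee_fin ?invr_ge0 ?exprn_ge0//.
  by apply/seteqP; split=> // t it; apply: no; exists t.
rewrite -(measure_cyl_iota hP p t0); apply: le_measure; rewrite ?inE.
- exact: measurable_depends_on dB.
- exact: measurable_cyl.
move=> t /= it; apply/cyl_seenP/draw_eqP/val_inj => /=.
have /andP[a b] := mem_block it; have /andP[c d] := mem_block it0.
case: (ltngtP (draw t) (draw t0)) => // /cut_le le.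
  by have := leq_trans b (leq_trans le c); rewrite ltnn.
by have := leq_trans d (leq_trans le a); rewrite ltnn.
Qed.

(** Taking all 2^p blocks at once gives an event in [w] alone, whatever block [t] draws. *)
Definition bad : set Omega := \big[setU/set0]_(j < 2 ^ p)
  forgetful (cut j) (cut j.+1) (undecided P f (cut j.+1)).

Lemma measurable_forgetful_cut j :
  measurable (forgetful (cut j) (cut j.+1) (undecided P f (cut j.+1))).
Proof.
apply: (@measurable_depends_on (cut j.+1)); apply: depends_on_forgetful.
exact: (cutP j).1.
Qed.

Lemma measurable_bad : measurable bad.
Proof. by apply: bigsetU_measurable => j _; exact: measurable_forgetful_cut. Qed.

Lemma measure_bad : (P bad <= ((2 ^ p)%:R * eta)%:E)%E.
Proof.
apply: (@le_trans _ _ (\sum_(j < 2 ^ p)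
    P (forgetful (cut j) (cut j.+1) (undecided P f (cut j.+1))))%E).
  apply: (@content_subadditive _ _ _ P bad (fun j : nat =>
      forgetful (cut j) (cut j.+1) (undecided P f (cut j.+1))) (2 ^ p)%N) => //.
  - by move=> j _; exact: measurable_forgetful_cut.
  - exact: measurable_bad.
apply: (@le_trans _ _ (\sum_(j < 2 ^ p) eta%:E)%E).
  by apply: lee_sum => j _; exact: (cutP j).2.
by rewrite sumEFin sumr_const card_ord mulr_natl.
Qed.

(** The composed algorithm reads the drawn block and then runs [sel]. The three terms of
    [inW_compose] are the revealment of [sel], the chance 2^-p of lying in the block, and the
    probability of [bad]. *)
Lemma revealment_le_Bm m sel : (cut (2 ^ p) <= m)%N ->
  algorithm_for P (Bm P m f) sel ->
  (revealment P f <= max_reveal (Bm P m f) sel + ((2%:R : R) ^- p + (2 ^ p)%:R * eta)%:E)%E.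
Proof.
move=> pm alg; have mB := measurable_Bm P mf m.
have mE : measurable (bad `*` [set: Omega]) by apply: measurableX => //; exact: measurable_bad.
apply: le_trans (revealment_le (compose_algorithm mB mf measurable_block finf alg)) _.
apply: ge_ereal_sup => _ [i _ <-].
apply: le_trans (inW_compose mB mf measurable_block finf alg mE _ i) _; last first.
  rewrite EFinD [leRHS]addeA; apply: leeD; last by rewrite PP_fst ?measure_bad//; exact: measurable_bad.
  by apply: leeD; [exact: max_reveal_ub|exact: measure_block].
move=> [w t] /= nE k sk nk.
have [b fb] : determines P (Bm P m f) (history sel w t k).
  by rewrite history_seen; exact: witness_determines sk.
exists b; apply/negligibleP; first exact: measurable_disagree.
have nfb : P.-negligible (cyl (history sel w t k) `&` [set w | Bm P m f w <> b]).
  by apply/negligibleP; [exact: measurable_disagree|exact: fb].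
have [Z [mZ Z0 HZ]] := ae_Bm_eq P mf m.
have nZ : P.-negligible Z by apply/negligibleP.
apply: negligibleS (negligibleU nfb nZ) => w'.
rewrite cyl_cat => -[[/cyl_seenP cb ch] /= ne].
(* If [Bm] and [f] differ at [w'], then [w'] is in the null set [Z] unless it is undecided at [m].
   In that case it is undecided at the end of the drawn block too, and as it agrees with [w] on that
   block, [w] would be bad. *)
have [eB|nB] := pselect (Bm P m f w' = f w'); [left; split=> //=; congruence|right].
apply: HZ; apply/not_implyP; split=> // um; apply: nE; split=> //.
have j2 : (draw t < 2 ^ p)%N by have := ltn_ord (draw t); rewrite {2}card_tuple card_bool.
rewrite /bad -(bigcup_mkord (2 ^ p) (fun j =>
  forgetful (cut j) (cut j.+1) (undecided P f (cut j.+1)))); exists (draw t) => //; exists w'; split=> //.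
by apply: undecided_le um => //; apply: leq_trans pm; exact: cut_le.
Qed.

End Lower.

(** * Choice of the parameters and passage to the limit *)

Lemma revealment_le_Bm_near (e : R) : uniform_product P -> 0 < e ->
  \forall m \near \oo, (revealment P f <= revealment P (Bm P m f) + e%:E)%E.
Proof.
move=> hP e0; have e20 : 0 < e / 2 by rewrite divr_gt0.
have [p Hp] : exists p, (2%:R : R) ^- p <= e / 2.
  (* The Archimedean bound exceeds 2 / e, and 2^p exceeds p. *)
  exists (Num.bound (2 / e)); rewrite -[leRHS]invrK invf_div lef_pV2 ?posrE ?divr_gt0 ?exprn_gt0//.
  apply: le_trans (ltW (archi_boundP _)) _; first by rewrite ltW// divr_gt0.
  by rewrite -natrX ler_nat ltnW// ltn_expl.
(* With this [eta] the bad event has probability at most e / 2. *)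
have eta0 : 0 < e / 2 / (2 ^ p)%:R by rewrite divr_gt0// ltr0n expn_gt0.
exists (cut hP eta0 (2 ^ p)) => // m /= Mm.
rewrite -leeBlDr//; apply: le_ereal_inf_tmp => _ [sel alg <-]; rewrite leeBlDr//.
apply: le_trans (revealment_le_Bm Mm alg) _; apply: leeD => //.
rewrite lee_fin mulrC divfK ?pnatr_eq0 -?lt0n ?expn_gt0//.
by rewrite [leRHS](splitr e) lerD2r.
Qed.

End Revealment.

Theorem mainTheorem18 (R : realType) (P : probability Omega R)
  (hP : uniform_product P) (f : Omega -> bool)
  (hfm : measurable_fun setT f) (hfin : finitary P f) :
  (revealment P (Bm P m f) @[m --> \oo] --> revealment P f)%E.
Proof.
have lower e := @revealment_le_Bm_near R P f hfm hfin e hP.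
(* The value [+oo] is treated first: the lower bound with slack 1 then makes the revealment of [Bm]
   infinite for all large [m]. *)
have := revealment_ge0 P f; case E : (revealment P f) => [r| |] //= _; last first.
  apply: cvg_near_cst; have := lower 1 ltr01; apply: filterS => m.
  by rewrite E; case: (revealment P (Bm P m f)).
have upper (e : R) : 0 < e -> \forall m \near \oo, (revealment P (Bm P m f) <= (r + e)%:E)%E.
  (* Half of [e] pays for a nearly optimal algorithm for [f], the other half for its runs that leave
     [m]. *)
  move=> e0; have e20 : 0 < e / 2 by rewrite divr_gt0.
  have frev : revealment P f \is a fin_num by rewrite E.
  have [sel [alg lt]] := revealment_adherent e20 frev.
  have := revealment_Bm_le hfm alg e20; apply: filterS => m le.
  apply: (le_trans le); rewrite [in leRHS](splitr e) addrA EFinD leeD2r//.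
  by rewrite EFinD -E ltW.
apply/fine_cvgP.
have finB : \forall m \near \oo, revealment P (Bm P m f) \is a fin_num.
  have := upper 1 ltr01; apply: filterS => m le.
  by rewrite ge0_fin_numE ?revealment_ge0// (le_lt_trans le) ?ltry.
split=> //; apply/cvgrPdist_le => e e0.
apply: filterS3 finB (upper e e0) (lower e e0) => m fm up lo.
move: up lo; rewrite E -(fineK fm) -EFinD !lee_fin => up lo.
by rewrite ler_distl lo andbT lerBlDr.
Qed.
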